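(* Let $(A,m,\eta,L,\mu,\alpha,\beta)$ be a Lie-Rinehart monoid in $\mathcal C$, let $(\mathfrak L,\mathfrak u)$ be a Lie monoid in $\mathcal C$, and let $\mathcal H:L\to\mathfrak L\otimes A$ be a crossed homomorphism. Then the category $\mathbf{WMod}^{\mathcal C}_A(L)$ of weak modules is a strict left module category over the monoidal category $\mathbf{Mod}_{\mathcal C}(\mathfrak L)$ of $\mathfrak L$-modules, the action being the bifunctor $$\mathcal F_{\mathcal H}:\mathbf{Mod}_{\mathcal C}(\mathfrak L)\times\mathbf{WMod}^{\mathcal C}_A(L)\to\mathbf{WMod}^{\mathcal C}_A(L),\qquad ((V,\psi),(M;\rho,\gamma))\mapsto (V\otimes M;\psi\vartriangleright\rho,\psi\vartriangleright\gamma),$$ where $$\psi\vartriangleright\rho=(\mathrm{id}_V\otimes\rho)\circ(c_{A,V}\otimes\mathrm{id}_M),$$ $$\psi\vartriangleright\gamma=(\mathrm{id}_V\otimes\gamma)\circ(c_{L,V}\otimes\mathrm{id}_M)+(\psi\otimes\rho)\circ(\mathrm{id}_{\mathfrak L}\otimes c_{A,V}\otimes\mathrm{id}_M)\circ(\mathcal H\otimes\mathrm{id}_V\otimes\mathrm{id}_M),$$ and where on morphisms $\mathcal F_{\mathcal H}(\varphi,\phi)=\varphi\otimes\phi$ for every homomorphism of $\mathfrak L$-modules $\varphi:V\to V'$ and every homomorphism of weak modules $\phi:M\to M'$.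
   Context: Standing setting: $\mathcal C=(\mathcal C,\otimes,I,c)$ is a strict symmetric monoidal category with unit $I$ and symmetric braiding $c_{V,W}:V\otimes W\to W\otimes V$, and it is $\mathbb C$-linear (Hom sets are complex vector spaces; composition and tensor product of morphisms are bilinear). A commutative monoid $(A,m,\eta)$ is an associative unital monoid object ($m:A\otimes A\to A$, $\eta:I\to A$) with $m\circ c_{A,A}=m$. An $A$-module $(M,\rho)$, $\rho:A\otimes M\to M$, is a left unital associative module. A Lie monoid $(L,\mu)$ is an object $L$ with $\mu:L\otimes L\to L$ such that $\mu=-\mu\circ c_{L,L}$ and $\mu\circ(\mathrm{id}_L\otimes\mu)=\mu\circ(\mu\otimes\mathrm{id}_L)+\mu\circ(\mathrm{id}_L\otimes\mu)\circ(c_{L,L}\otimes\mathrm{id}_L)$. An $L$-module $(M,\gamma)$ is an object $M$ with $\gamma:L\otimes M\to M$ such that $\gamma\circ(\mathrm{id}_L\otimes\gamma)=\gamma\circ(\mu\otimes\mathrm{id}_M)+\gamma\circ(\mathrm{id}_L\otimes\gamma)\circ(c_{L,L}\otimes\mathrm{id}_M)$. A homomorphism of ($A$- or $L$-)modules is a morphism commuting with the actions. $\mathbf{Mod}_{\mathcal C}(L)$, the category of $L$-modules, is strict monoidal with $(V,\psi)\otimes(W,\theta)=(V\otimes W,\psi\boxplus\theta)$, $\psi\boxplus\theta=\psi\otimes\mathrm{id}_W+(\mathrm{id}_V\otimes\theta)\circ(c_{L,V}\otimes\mathrm{id}_W)$, and unit $(I,\mathbf 0)$ ($\mathbf 0$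 the zero morphism). A Lie-Rinehart monoid $(A,m,\eta,L,\mu,\alpha,\beta)$ (abbreviated $(A,L,\alpha)$) consists of a commutative monoid $(A,m,\eta)$, a Lie monoid $(L,\mu)$, an $A$-module structure $\beta:A\otimes L\to L$ on $L$, and a morphism $\alpha:L\otimes A\to A$ (the anchor) such that (i) $\alpha\circ(\mathrm{id}_L\otimes m)=m\circ(\alpha\otimes\mathrm{id}_A)+m\circ(\mathrm{id}_A\otimes\alpha)\circ(c_{L,A}\otimes\mathrm{id}_A)$; (ii) $\alpha\circ(\beta\otimes\mathrm{id}_A)=m\circ(\mathrm{id}_A\otimes\alpha)$; (iii) $\alpha\circ(\mathrm{id}_L\otimes\alpha)=\alpha\circ(\mu\otimes\mathrm{id}_A)+\alpha\circ(\mathrm{id}_L\otimes\alpha)\circ(c_{L,L}\otimes\mathrm{id}_A)$; (iv) $\mu\circ(\mathrm{id}_L\otimes\beta)=\beta\circ(\alpha\otimes\mathrm{id}_L)+\beta\circ(\mathrm{id}_A\otimes\mu)\circ(c_{L,A}\otimes\mathrm{id}_L)$. A weak module $(M;\rho,\gamma)$ over it is an object $M$ with an $A$-module structure $\rho$ and an $L$-module structure $\gamma$ such that $\gamma\circ(\mathrm{id}_L\otimes\rho)=\rho\circ(\alpha\otimes\mathrm{id}_M)+\rho\circ(\mathrm{id}_A\otimes\gamma)\circ(c_{L,A}\otimes\mathrm{id}_M)$. Homomorphisms of weak modules are morphisms that are both $A$-module and $L$-module homomorphisms; the resulting category is $\mathbf{WMod}^{\mathcal C}_A(L)$. For a Lie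 monoid $(\mathfrak L,\mathfrak u)$, a crossed homomorphism is a morphism $\mathcal H:L\to\mathfrak L\otimes A$ with $$\mathcal H\circ\mu=(\mathrm{id}_{\mathfrak L}\otimes\alpha)\circ(c_{L,\mathfrak L}\otimes\mathrm{id}_A)\circ(\mathrm{id}_L\otimes\mathcal H)-(\mathrm{id}_{\mathfrak L}\otimes(\alpha\circ c_{A,L}))\circ(\mathcal H\otimes\mathrm{id}_L)+(\mathfrak u\otimes m)\circ(\mathrm{id}_{\mathfrak L}\otimes c_{A,\mathfrak L}\otimes\mathrm{id}_A)\circ(\mathcal H\otimes\mathcal H).$$ A left module category over a strict monoidal category $\mathcal D$ is a category $\mathcal M$ with a bifunctor $\vartriangleright:\mathcal D\times\mathcal M\to\mathcal M$ and natural isomorphisms $(U\otimes V)\vartriangleright Z\cong U\vartriangleright(V\vartriangleright Z)$ and $I\vartriangleright Z\cong Z$ satisfying the usual pentagon and triangle axioms; it is strict if these natural isomorphisms are all identities. *)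

(* Defs.v *)
From HB Require Import structures.
From mathcomp Require Import all_boot all_algebra.
From mathcomp Require Import boolp.

Set Implicit Arguments.
Unset Strict Implicit.
Unset Printing Implicit Defensive.

Import GRing.Theory.
Local Open Scope ring_scope.

Declare Scope cat_scope.
Delimit Scope cat_scope with C.
Local Open Scope cat_scope.

Record category := Category {
  ob :> Type;
  mor : ob -> ob -> Type;
  idm : forall U : ob, mor U U;
  compm : forall U V W : ob, mor V W -> mor U V -> mor U W;
  comp_idl : forall (U V : ob) (f : mor U V), compm (idm V) f = f;
  comp_idr : forall (U V : ob) (f : mor U V), compm f (idm U) = f;
  comp_assoc : forall (U V W X : ob) (f : mor W X) (g : mor V W) (h : mor U V),
    compm f (compm g h) = compm (compm f g) h }.

Arguments mor {c} U V.
Arguments idm {c} U.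
Arguments compm {c U V W} f g.
Notation "f ∘ g" := (compm f g) (at level 40, left associativity) : cat_scope.

(* An equality of objects seen as a morphism: the "identity" U -> V. Since
   equality proofs are irrelevant, it does not depend on e. *)
Definition eq_hom (C : category) (U V : C) (e : U = V) : mor U V :=
  match e in _ = W return mor U W with erefl => idm U end.

Definition is_iso (C : category) (U V : C) (f : mor U V) : Prop :=
  exists g : mor V U, g ∘ f = idm U /\ f ∘ g = idm V.

Record is_bifunctor (C D E : category) (F : C -> D -> E)
    (Fm : forall (U U' : C) (Z Z' : D),
      mor U U' -> mor Z Z' -> mor (F U Z) (F U' Z')) : Prop := {
  is_bifunctor_id : forall (U : C) (Z : D), Fm U U Z Z (idm U) (idm Z) = idm (F U Z);
  is_bifunctor_comp : forall (U U' U'' : C) (Z Z' Z'' : D)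
      (f : mor U' U'') (g : mor U U') (h : mor Z' Z'') (k : mor Z Z'),
    Fm U U'' Z Z'' (f ∘ g) (h ∘ k) = Fm U' U'' Z' Z'' f h ∘ Fm U U' Z Z' g k }.

Record bifunctor (C D E : category) := Bifunctor {
  bif_ob :> C -> D -> E;
  bif_hom : forall (U U' : C) (Z Z' : D),
    mor U U' -> mor Z Z' -> mor (bif_ob U Z) (bif_ob U' Z');
  bifP : is_bifunctor bif_hom }.

Arguments bif_hom {C D E} b {U U' Z Z'} f g.

(* In a strict monoidal category the associator and the unitors are
   identities; (U ⊗ V) ⊗ W and U ⊗ (V ⊗ W) are only propositionally equal, so
   these identities are the morphisms eq_hom of the object equalities. The
   pentagon and triangle axioms then hold by irrelevance of equality proofs. *)
Record strict_monoidal := StrictMonoidal {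
  sm_cat :> category;
  tensor : bifunctor sm_cat sm_cat sm_cat;
  munit : sm_cat;
  tensorA : forall U V W : sm_cat,
    tensor (tensor U V) W = tensor U (tensor V W);
  tensor1l : forall U : sm_cat, tensor munit U = U;
  tensor1r : forall U : sm_cat, tensor U munit = U;
  tensor_homA : forall (U U' V V' W W' : sm_cat)
      (f : mor U U') (g : mor V V') (h : mor W W'),
    eq_hom (tensorA U' V' W') ∘ bif_hom tensor (bif_hom tensor f g) h =
    bif_hom tensor f (bif_hom tensor g h) ∘ eq_hom (tensorA U V W);
  tensor_hom1l : forall (U U' : sm_cat) (f : mor U U'),
    eq_hom (tensor1l U') ∘ bif_hom tensor (idm munit) f =
    f ∘ eq_hom (tensor1l U);
  tensor_hom1r : forall (U U' : sm_cat) (f : mor U U'),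
    eq_hom (tensor1r U') ∘ bif_hom tensor f (idm munit) =
    f ∘ eq_hom (tensor1r U) }.

Arguments munit {s}.
Notation "U ⊗ V" := (tensor _ U V)
  (at level 38, right associativity) : cat_scope.
Notation "f ⊗₁ g" := (bif_hom (tensor _) f g)
  (at level 38, right associativity) : cat_scope.

Section StrictNotions.
Variable C : strict_monoidal.
Implicit Types U V W X Y Z : C.

Definition asc U V W : mor ((U ⊗ V) ⊗ W) (U ⊗ (V ⊗ W)) :=
  eq_hom (tensorA U V W).
Definition asci U V W : mor (U ⊗ (V ⊗ W)) ((U ⊗ V) ⊗ W) :=
  eq_hom (esym (tensorA U V W)).
Definition unl U : mor (munit ⊗ U) U := eq_hom (tensor1l U).
Definition unr U : mor (U ⊗ munit) U := eq_hom (tensor1r U).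

(* f ⊗ id_W for f : X ⊗ Y -> Z, with X ⊗ Y ⊗ W bracketed to the right *)
Definition widen X Y Z (f : mor (X ⊗ Y) Z) W : mor (X ⊗ (Y ⊗ W)) (Z ⊗ W) :=
  (f ⊗₁ idm W) ∘ asci X Y W.

End StrictNotions.

Notation "f ▹ W" := (widen f W) (at level 37, left associativity) : cat_scope.

Record left_module_category (D : strict_monoidal) (M : category) :=
    LeftModuleCategory {
  lmc_act : bifunctor D M M;
  lmc_assoc : forall (U V : D) (Z : M),
    mor (lmc_act (U ⊗ V) Z) (lmc_act U (lmc_act V Z));
  lmc_unit : forall Z : M, mor (lmc_act munit Z) Z;
  lmc_assoc_iso : forall U V Z, is_iso (lmc_assoc U V Z);
  lmc_unit_iso : forall Z, is_iso (lmc_unit Z);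
  lmc_assoc_nat : forall (U U' V V' : D) (Z Z' : M)
      (f : mor U U') (g : mor V V') (h : mor Z Z'),
    lmc_assoc U' V' Z' ∘ bif_hom lmc_act (f ⊗₁ g) h =
    bif_hom lmc_act f (bif_hom lmc_act g h) ∘ lmc_assoc U V Z;
  lmc_unit_nat : forall (Z Z' : M) (h : mor Z Z'),
    lmc_unit Z' ∘ bif_hom lmc_act (idm munit) h = h ∘ lmc_unit Z;
  lmc_pentagon : forall (U V W : D) (Z : M),
    lmc_assoc U V (lmc_act W Z) ∘ lmc_assoc (U ⊗ V) W Z =
    bif_hom lmc_act (idm U) (lmc_assoc V W Z) ∘ lmc_assoc U (V ⊗ W) Z
      ∘ bif_hom lmc_act (asc U V W) (idm Z);
  lmc_triangle : forall (U : D) (Z : M),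
    bif_hom lmc_act (idm U) (lmc_unit Z) ∘ lmc_assoc U munit Z =
    bif_hom lmc_act (unr U) (idm Z) }.

Definition lmc_strict (D : strict_monoidal) (M : category)
    (N : left_module_category D M) : Prop :=
  (forall (U V : D) (Z : M),
     exists e : lmc_act N (U ⊗ V) Z = lmc_act N U (lmc_act N V Z),
       lmc_assoc N U V Z = eq_hom e) /\
  (forall Z : M,
     exists e : lmc_act N munit Z = Z, lmc_unit N Z = eq_hom e).

(* A K-vector space structure on each morphism space; bilinearity of ∘ and ⊗
   is imposed in sym_linear_category. *)
Record hom_linear (K : fieldType) := HomLinear {
  hl_mon :> strict_monoidal;
  hl_class : forall U V : hl_mon, GRing.Lmodule K (mor U V) }.

HB.instance Definition _ (K : fieldType) (C : hom_linear K) (U V : C) :=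
  GRing.Lmodule.copy (mor U V) (GRing.Lmodule.Pack (hl_class U V)).

Record sym_linear_category (K : fieldType) := SymLinearCategory {
  slc_mon :> hom_linear K;
  comp_linearl : forall (U V W : slc_mon) (a : K) (f f' : mor V W) (g : mor U V),
    (a *: f + f') ∘ g = a *: (f ∘ g) + f' ∘ g;
  comp_linearr : forall (U V W : slc_mon) (a : K) (f : mor V W) (g g' : mor U V),
    f ∘ (a *: g + g') = a *: (f ∘ g) + f ∘ g';
  tensor_linearl : forall (U U' V V' : slc_mon) (a : K)
      (f f' : mor U U') (g : mor V V'),
    (a *: f + f') ⊗₁ g = a *: (f ⊗₁ g) + f' ⊗₁ g;
  tensor_linearr : forall (U U' V V' : slc_mon) (a : K)
      (f : mor U U') (g g' : mor V V'),
    f ⊗₁ (a *: g + g') = a *: (f ⊗₁ g) + f ⊗₁ g';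
  braid : forall U V : slc_mon, mor (U ⊗ V) (V ⊗ U);
  braid_nat : forall (U U' V V' : slc_mon) (f : mor U U') (g : mor V V'),
    braid U' V' ∘ (f ⊗₁ g) = (g ⊗₁ f) ∘ braid U V;
  braid_sym : forall U V : slc_mon, braid V U ∘ braid U V = idm (U ⊗ V);
  (* c_{U, V ⊗ W} = (id_V ⊗ c_{U, W}) ∘ (c_{U, V} ⊗ id_W); the other hexagon
     follows from this one and braid_sym. *)
  braid_hexagon : forall U V W : slc_mon,
    asc V W U ∘ braid U (V ⊗ W) ∘ asc U V W =
    (idm V ⊗₁ braid U W) ∘ asc V U W ∘ (braid U V ⊗₁ idm W) }.

Section Structures.
Variables (K : fieldType) (C : sym_linear_category K).
Implicit Types U V W X : C.

(* c_{U, V} ⊗ id_W, with both triple products bracketed to the right *)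
Definition braidw U V W : mor (U ⊗ (V ⊗ W)) (V ⊗ (U ⊗ W)) :=
  asc V U W ∘ (braid U V ▹ W).

(* id_U ⊗ c_{V, W} ⊗ id_X *)
Definition mid U V W X : mor ((U ⊗ V) ⊗ (W ⊗ X)) ((U ⊗ W) ⊗ (V ⊗ X)) :=
  asci U W (V ⊗ X) ∘ (idm U ⊗₁ braidw V W X) ∘ asc U V (W ⊗ X).

Record comm_monoid := CommMonoid {
  cm_ob :> C;
  cm_mul : mor (cm_ob ⊗ cm_ob) cm_ob;
  cm_unit : mor munit cm_ob;
  cm_mulA : cm_mul ∘ (idm cm_ob ⊗₁ cm_mul) = cm_mul ∘ (cm_mul ▹ cm_ob);
  cm_mul1l : cm_mul ∘ (cm_unit ⊗₁ idm cm_ob) = unl cm_ob;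
  cm_mul1r : cm_mul ∘ (idm cm_ob ⊗₁ cm_unit) = unr cm_ob;
  cm_mulC : cm_mul ∘ braid cm_ob cm_ob = cm_mul }.

Record is_amodule (A : comm_monoid) (M : C) (rho : mor (A ⊗ M) M) : Prop := {
  amodule_mul : rho ∘ (idm A ⊗₁ rho) = rho ∘ (cm_mul A ▹ M);
  amodule_unit : rho ∘ (cm_unit A ⊗₁ idm M) = unl M }.

Record lie_monoid := LieMonoid {
  lie_ob :> C;
  lie_br : mor (lie_ob ⊗ lie_ob) lie_ob;
  lie_anti : lie_br = - (lie_br ∘ braid lie_ob lie_ob);
  lie_jacobi : lie_br ∘ (idm lie_ob ⊗₁ lie_br) =
    lie_br ∘ (lie_br ▹ lie_ob) +
    lie_br ∘ (idm lie_ob ⊗₁ lie_br) ∘ braidw lie_ob lie_ob lie_ob }.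

Definition is_lmodule (L : lie_monoid) (M : C) (gamma : mor (L ⊗ M) M) : Prop :=
  gamma ∘ (idm L ⊗₁ gamma) =
  gamma ∘ (lie_br L ▹ M) + gamma ∘ (idm L ⊗₁ gamma) ∘ braidw L L M.

Record lie_rinehart := LieRinehart {
  lrA : comm_monoid;
  lrL : lie_monoid;
  lr_act : mor (lrA ⊗ lrL) lrL;
  lr_anchor : mor (lrL ⊗ lrA) lrA;
  lr_actP : is_amodule lr_act;
  lr_deriv : lr_anchor ∘ (idm lrL ⊗₁ cm_mul lrA) =
    cm_mul lrA ∘ (lr_anchor ▹ lrA) +
    cm_mul lrA ∘ (idm lrA ⊗₁ lr_anchor) ∘ braidw lrL lrA lrA;
  lr_anchor_act : lr_anchor ∘ (lr_act ▹ lrA) =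
    cm_mul lrA ∘ (idm lrA ⊗₁ lr_anchor);
  lr_anchor_br : lr_anchor ∘ (idm lrL ⊗₁ lr_anchor) =
    lr_anchor ∘ (lie_br lrL ▹ lrA) +
    lr_anchor ∘ (idm lrL ⊗₁ lr_anchor) ∘ braidw lrL lrL lrA;
  lr_leibniz : lie_br lrL ∘ (idm lrL ⊗₁ lr_act) =
    lr_act ∘ (lr_anchor ▹ lrL) +
    lr_act ∘ (idm lrA ⊗₁ lie_br lrL) ∘ braidw lrL lrA lrL }.

Record is_weak_module (X : lie_rinehart) (M : C)
    (rho : mor (lrA X ⊗ M) M) (gamma : mor (lrL X ⊗ M) M) : Prop := {
  weak_amodule : is_amodule rho;
  weak_lmodule : is_lmodule gamma;
  weak_compat : gamma ∘ (idm (lrL X) ⊗₁ rho) =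
    rho ∘ (lr_anchor X ▹ M) +
    rho ∘ (idm (lrA X) ⊗₁ gamma) ∘ braidw (lrL X) (lrA X) M }.

Definition is_crossed_hom (X : lie_rinehart) (G : lie_monoid)
    (H : mor (lrL X) (G ⊗ lrA X)) : Prop :=
  H ∘ lie_br (lrL X) =
    (idm G ⊗₁ lr_anchor X) ∘ braidw (lrL X) G (lrA X) ∘ (idm (lrL X) ⊗₁ H)
  - (idm G ⊗₁ (lr_anchor X ∘ braid (lrA X) (lrL X)))
      ∘ asc G (lrA X) (lrL X) ∘ (H ⊗₁ idm (lrL X))
  + (lie_br G ⊗₁ cm_mul (lrA X)) ∘ mid G (lrA X) G (lrA X) ∘ (H ⊗₁ H).

Record lie_module (L : lie_monoid) := LieModule {
  lm_ob :> C;
  lm_act : mor (L ⊗ lm_ob) lm_ob;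
  lm_actP : is_lmodule lm_act }.

Record weak_module (X : lie_rinehart) := WeakModule {
  wm_ob :> C;
  wm_rho : mor (lrA X ⊗ wm_ob) wm_ob;
  wm_gamma : mor (lrL X ⊗ wm_ob) wm_ob;
  wmP : is_weak_module wm_rho wm_gamma }.

Definition equivariant U V W (a : mor (U ⊗ V) V) (b : mor (U ⊗ W) W)
    (f : mor V W) : Prop :=
  f ∘ a = b ∘ (idm U ⊗₁ f).

Definition lie_module_hom (L : lie_monoid) (M N : lie_module L) : Type :=
  {f : mor (M : C) N | equivariant (lm_act M) (lm_act N) f}.

Definition is_weak_module_hom (X : lie_rinehart) (M N : weak_module X)
    (f : mor (M : C) N) : Prop :=
  equivariant (wm_rho M) (wm_rho N) f /\
  equivariant (wm_gamma M) (wm_gamma N) f.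

Definition weak_module_hom (X : lie_rinehart) (M N : weak_module X) : Type :=
  {f : mor (M : C) N | is_weak_module_hom f}.

End Structures.

Section EqHom.

Lemma eq_hom_irr (C : category) (U V : C) (e e' : U = V) : eq_hom e = eq_hom e'.
Proof. by rewrite (Prop_irrelevance e e'). Qed.

Lemma eq_hom_id (C : category) (U : C) (e : U = U) : eq_hom e = idm U.
Proof. exact: (eq_hom_irr e erefl). Qed.

Lemma eq_hom_trans (C : category) (U V W : C) (e : U = V) (e' : V = W) :
  eq_hom e' ∘ eq_hom e = eq_hom (etrans e e').
Proof. by case: W / e'; case: V / e; rewrite /= comp_idl. Qed.

Lemma eq_homK (C : category) (U V : C) (e : U = V) (e' : V = U) :
  eq_hom e' ∘ eq_hom e = idm U.
Proof. by rewrite eq_hom_trans eq_hom_id. Qed.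

Lemma eq_hom_transA (C : category) (U V W X : C) (e : V = W) (e' : W = X)
    (f : mor U V) :
  eq_hom e' ∘ (eq_hom e ∘ f) = eq_hom (etrans e e') ∘ f.
Proof. by rewrite comp_assoc eq_hom_trans. Qed.

Lemma comp_congr (C : category) (U V W : C) (f f' : mor V W) (g g' : mor U V) :
  f = f' -> g = g' -> f ∘ g = f' ∘ g'.
Proof. by move=> -> ->. Qed.

Lemma comp_eq_homI (C : category) (U V W : C) (e : V = W) (f g : mor U V) :
  eq_hom e ∘ f = eq_hom e ∘ g -> f = g.
Proof. by case: W / e; rewrite /= !comp_idl. Qed.

Lemma comp_eq_homIr (C : category) (U V W : C) (e : U = V) (f g : mor V W) :
  f ∘ eq_hom e = g ∘ eq_hom e -> f = g.
Proof. by case: V / e f g => f g; rewrite /= !comp_idr. Qed.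

End EqHom.

Section StrictTheory.
Variable C : strict_monoidal.
Implicit Types U V W X Y Z : C.

Lemma tensor_id U V : idm U ⊗₁ idm V = idm (U ⊗ V).
Proof. exact: is_bifunctor_id (bifP (tensor C)) U V. Qed.

Lemma tensor_comp (U U' U'' V V' V'' : C) (f : mor U' U'') (g : mor U U')
    (h : mor V' V'') (k : mor V V') :
  (f ∘ g) ⊗₁ (h ∘ k) = (f ⊗₁ h) ∘ (g ⊗₁ k).
Proof. exact: is_bifunctor_comp (bifP (tensor C)) _ _ _ _ _ _ f g h k. Qed.

Lemma tensor_compl U V V' V'' (f : mor V' V'') (g : mor V V') :
  idm U ⊗₁ (f ∘ g) = (idm U ⊗₁ f) ∘ (idm U ⊗₁ g).
Proof. by rewrite -tensor_comp comp_idl. Qed.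

Lemma tensor_compr U V V' V'' (f : mor V' V'') (g : mor V V') :
  (f ∘ g) ⊗₁ idm U = (f ⊗₁ idm U) ∘ (g ⊗₁ idm U).
Proof. by rewrite -tensor_comp comp_idl. Qed.

Lemma tensor_split U U' V V' (f : mor U U') (g : mor V V') :
  f ⊗₁ g = (f ⊗₁ idm V') ∘ (idm U ⊗₁ g).
Proof. by rewrite -tensor_comp comp_idl comp_idr. Qed.

Lemma tensor_split' U U' V V' (f : mor U U') (g : mor V V') :
  f ⊗₁ g = (idm U' ⊗₁ g) ∘ (f ⊗₁ idm V).
Proof. by rewrite -tensor_comp comp_idl comp_idr. Qed.

Lemma tensor_eq_homr U V W (e : U = V) :
  eq_hom e ⊗₁ idm W = eq_hom (congr1 (fun Z => Z ⊗ W) e).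
Proof. by case: V / e; rewrite /= tensor_id. Qed.

Lemma tensor_eq_homl U V W (e : U = V) :
  idm W ⊗₁ eq_hom e = eq_hom (congr1 (fun Z => W ⊗ Z) e).
Proof. by case: V / e; rewrite /= tensor_id. Qed.

Lemma ascK U V W : asci U V W ∘ asc U V W = idm _.
Proof. exact: eq_homK. Qed.

Lemma asciK U V W : asc U V W ∘ asci U V W = idm _.
Proof. exact: eq_homK. Qed.

Lemma asc_nat U U' V V' W W' (f : mor U U') (g : mor V V') (h : mor W W') :
  asc U' V' W' ∘ ((f ⊗₁ g) ⊗₁ h) = (f ⊗₁ (g ⊗₁ h)) ∘ asc U V W.
Proof. exact: tensor_homA. Qed.

Lemma asci_nat U U' V V' W W' (f : mor U U') (g : mor V V') (h : mor W W') :
  asci U' V' W' ∘ (f ⊗₁ (g ⊗₁ h)) = ((f ⊗₁ g) ⊗₁ h) ∘ asci U V W.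
Proof.
rewrite -[LHS]comp_idr -(asciK U V W) comp_assoc -(comp_assoc (asci _ _ _)).
by rewrite -asc_nat comp_assoc ascK comp_idl.
Qed.

Lemma widen_natr X Y Z (f : mor (X ⊗ Y) Z) W W' (g : mor W W') :
  (f ▹ W') ∘ (idm X ⊗₁ (idm Y ⊗₁ g)) = (idm Z ⊗₁ g) ∘ (f ▹ W).
Proof.
by rewrite /widen -comp_assoc asci_nat tensor_id !comp_assoc -!tensor_comp
  !comp_idl !comp_idr.
Qed.

Lemma widen_post X Y Z Z' (f : mor (X ⊗ Y) Z) (g : mor Z Z') W :
  (g ∘ f) ▹ W = (g ⊗₁ idm W) ∘ (f ▹ W).
Proof. by rewrite /widen comp_assoc tensor_compr. Qed.

Lemma widen_pre X X' Y Y' Z (f : mor (X ⊗ Y) Z) (g : mor X' X) (h : mor Y' Y) W :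
  (f ∘ (g ⊗₁ h)) ▹ W = (f ▹ W) ∘ (g ⊗₁ (h ⊗₁ idm W)).
Proof. by rewrite /widen -comp_assoc asci_nat tensor_compr comp_assoc. Qed.

Lemma widen_asc X Y Z (f : mor (X ⊗ Y) Z) V W :
  (asc Z V W) ∘ ((f ▹ V) ⊗₁ idm W) ∘ asci X (Y ⊗ V) W ∘ (idm X ⊗₁ asci Y V W) =
  f ▹ (V ⊗ W).
Proof.
rewrite /widen tensor_compr comp_assoc asc_nat tensor_id -!comp_assoc.
congr (_ ∘ _); rewrite /asc /asci tensor_eq_homr tensor_eq_homl !eq_hom_trans.
exact: eq_hom_irr.
Qed.

Lemma widen_widen X Y Z (f : mor (X ⊗ Y) Z) V W :
  ((f ▹ V) ▹ W) ∘ (idm X ⊗₁ asci Y V W) = asci Z V W ∘ (f ▹ (V ⊗ W)).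
Proof.
rewrite -widen_asc -[_ ∘ asci _ _ _ ∘ _ in RHS]comp_assoc /widen.
by rewrite !comp_assoc ascK comp_idl.
Qed.

Lemma widen_nest X Y X' Y' Z (f : mor (X ⊗ Y) Z) (g : mor (X' ⊗ Y') Y) W :
  ((f ∘ (idm X ⊗₁ g)) ▹ W) ∘ (idm X ⊗₁ asci X' Y' W) =
  (f ▹ W) ∘ (idm X ⊗₁ (g ▹ W)).
Proof. by rewrite widen_pre -comp_assoc -tensor_compl. Qed.

End StrictTheory.

Section LinearTheory.
Variables (K : fieldType) (C : sym_linear_category K).
Implicit Types U V W X Y Z : C.

Lemma compDl U V W (f f' : mor V W) (g : mor U V) :
  (f + f') ∘ g = f ∘ g + f' ∘ g.
Proof. by have := comp_linearl 1 f f' g; rewrite !scale1r. Qed.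

Lemma compDr U V W (f : mor V W) (g g' : mor U V) :
  f ∘ (g + g') = f ∘ g + f ∘ g'.
Proof. by have := comp_linearr 1 f g g'; rewrite !scale1r. Qed.

Lemma tensorDl U U' V V' (f f' : mor U U') (g : mor V V') :
  (f + f') ⊗₁ g = f ⊗₁ g + f' ⊗₁ g.
Proof. by have := tensor_linearl 1 f f' g; rewrite !scale1r. Qed.

Lemma tensorDr U U' V V' (f : mor U U') (g g' : mor V V') :
  f ⊗₁ (g + g') = f ⊗₁ g + f ⊗₁ g'.
Proof. by have := tensor_linearr 1 f g g'; rewrite !scale1r. Qed.

Lemma comp0l U V W (g : mor U V) : (0 : mor V W) ∘ g = 0.
Proof. by apply: (addrI ((0 : mor V W) ∘ g)); rewrite -compDl !addr0. Qed.

Lemma comp0r U V W (f : mor V W) : f ∘ (0 : mor U V) = 0.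
Proof. by apply: (addrI (f ∘ (0 : mor U V))); rewrite -compDr !addr0. Qed.

Lemma tensor0l U U' V V' (g : mor V V') : (0 : mor U U') ⊗₁ g = 0.
Proof. by apply: (addrI ((0 : mor U U') ⊗₁ g)); rewrite -tensorDl !addr0. Qed.

Lemma tensor0r U U' V V' (f : mor U U') : f ⊗₁ (0 : mor V V') = 0.
Proof. by apply: (addrI (f ⊗₁ (0 : mor V V'))); rewrite -tensorDr !addr0. Qed.

Lemma widenD X Y Z (f g : mor (X ⊗ Y) Z) W : (f + g) ▹ W = f ▹ W + g ▹ W.
Proof. by rewrite /widen tensorDl compDl. Qed.

Lemma braidwE U V W :
  braidw U V W = asc V U W ∘ (braid U V ⊗₁ idm W) ∘ asci U V W.
Proof. by rewrite /braidw /widen comp_assoc. Qed.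

Lemma braidw_sym U V W : braidw V U W ∘ braidw U V W = idm _.
Proof.
rewrite !braidwE -!comp_assoc (comp_assoc (asci V U W)) ascK comp_idl.
rewrite (comp_assoc (braid V U ⊗₁ _)) -tensor_compr braid_sym tensor_id comp_idl.
exact: asciK.
Qed.

Lemma braidw_nat U U' V V' W W' (f : mor U U') (g : mor V V') (h : mor W W') :
  braidw U' V' W' ∘ (f ⊗₁ (g ⊗₁ h)) = (g ⊗₁ (f ⊗₁ h)) ∘ braidw U V W.
Proof.
rewrite !braidwE -!comp_assoc asci_nat (comp_assoc (braid U' V' ⊗₁ _)).
rewrite -tensor_comp braid_nat comp_idl -{1}(comp_idr h).
by rewrite tensor_comp -!comp_assoc comp_assoc asc_nat -comp_assoc.
Qed.

Lemma braidE U V W :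
  braid U (V ⊗ W) = asci V W U ∘ (idm V ⊗₁ braid U W) ∘ asc V U W
                      ∘ (braid U V ⊗₁ idm W) ∘ asci U V W.
Proof.
rewrite -!comp_assoc [(idm V ⊗₁ _) ∘ _]comp_assoc [_ ∘ _ ∘ (_ ∘ asci _ _ _)]comp_assoc.
by rewrite -braid_hexagon -!comp_assoc asciK comp_idr comp_assoc ascK comp_idl.
Qed.

Lemma tensor_layerl U V V' W (f : mor V V') :
  (idm U ⊗₁ f) ⊗₁ idm W = asci U V' W ∘ (idm U ⊗₁ (f ⊗₁ idm W)) ∘ asc U V W.
Proof. by rewrite asci_nat -comp_assoc ascK comp_idr. Qed.

Lemma tensor_layerr U U' V W (f : mor U U') :
  (f ⊗₁ idm V) ⊗₁ idm W = asci U' V W ∘ (f ⊗₁ idm (V ⊗ W)) ∘ asc U V W.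
Proof. by rewrite -tensor_id asci_nat -comp_assoc ascK comp_idr. Qed.

Lemma braidw_tensorr U V W X :
  asc V W (U ⊗ X) ∘ braidw U (V ⊗ W) X ∘ (idm U ⊗₁ asci V W X) =
  (idm V ⊗₁ braidw U W X) ∘ braidw U V (W ⊗ X).
Proof.
rewrite !braidwE braidE !tensor_compr !tensor_compl tensor_layerl tensor_layerr.
rewrite /asc /asci !(tensor_eq_homl, tensor_eq_homr).
rewrite -!comp_assoc !(eq_hom_trans, eq_hom_transA).
do 4! (apply: comp_congr; [by [] || exact: eq_hom_irr |]); exact: eq_hom_irr.
Qed.

Lemma tensor_ascK U V W X : (idm U ⊗₁ asci V W X) ∘ (idm U ⊗₁ asc V W X) = idm _.
Proof. by rewrite -tensor_compl ascK tensor_id. Qed.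

Lemma tensor_asciK U V W X : (idm U ⊗₁ asc V W X) ∘ (idm U ⊗₁ asci V W X) = idm _.
Proof. by rewrite -tensor_compl asciK tensor_id. Qed.

Lemma braidw_tensorl U V W X :
  (idm W ⊗₁ asc U V X) ∘ braidw (U ⊗ V) W X ∘ asci U V (W ⊗ X) =
  braidw U W (V ⊗ X) ∘ (idm U ⊗₁ braidw V W X).
Proof.
have inj : forall (Y : C) (f g : mor Y (W ⊗ (U ⊗ (V ⊗ X)))),
    (idm U ⊗₁ braidw W V X) ∘ braidw W U (V ⊗ X) ∘ f =
    (idm U ⊗₁ braidw W V X) ∘ braidw W U (V ⊗ X) ∘ g -> f = g.
  set Q := _ ∘ braidw W U _; set P := braidw U W (V ⊗ X) ∘ (idm U ⊗₁ braidw V W X).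
  have PQ : P ∘ Q = idm _.
    rewrite /P /Q comp_assoc -(comp_assoc (braidw U W _)) -tensor_compl.
    by rewrite braidw_sym tensor_id comp_idr braidw_sym.
  move=> Y f g /(congr1 (compm P)).
  by rewrite !(comp_assoc P Q) PQ !comp_idl.
apply: inj; rewrite -[LHS]comp_assoc [in RHS]comp_assoc.
rewrite -[in RHS](comp_assoc _ (braidw W U _)) braidw_sym comp_idr -tensor_compl.
rewrite braidw_sym tensor_id; move: (braidw_sym (U ⊗ V) W X).
rewrite comp_assoc -braidw_tensorr.
move: (braidw W (U ⊗ V) X) (braidw (U ⊗ V) W X) => b b' bb'.
rewrite !comp_assoc -(comp_assoc (_ ∘ _) (_ ⊗₁ asci _ _ _)) tensor_ascK comp_idr.
by rewrite -(comp_assoc _ b) bb' comp_idr asciK.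
Qed.

Lemma braidw_widen U X Y Z (f : mor (X ⊗ Y) Z) W :
  braidw U Z W ∘ (idm U ⊗₁ (f ▹ W)) =
  (f ▹ (U ⊗ W)) ∘ (idm X ⊗₁ braidw U Y W) ∘ braidw U X (Y ⊗ W).
Proof.
rewrite {1}/widen tensor_compl comp_assoc braidw_nat tensor_id /widen.
move: (braidw_tensorr U X Y W).
move: (braidw U (X ⊗ Y) W) (braidw U Y W) (braidw U X _) => b b1 b2 E.
rewrite -!comp_assoc -E; congr (_ ∘ _).
by rewrite !comp_assoc ascK comp_idl.
Qed.

Lemma widen_braidw V X Y Z (f : mor (X ⊗ Y) Z) W :
  braidw Z V W ∘ (f ▹ (V ⊗ W)) =
  (idm V ⊗₁ (f ▹ W)) ∘ braidw X V (Y ⊗ W) ∘ (idm X ⊗₁ braidw Y V W).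
Proof.
rewrite {1}/widen -tensor_id comp_assoc braidw_nat /widen tensor_compl.
move: (braidw_tensorl X Y V W).
move: (braidw (X ⊗ Y) V W) (braidw X V _) (braidw Y V W) => b b1 b2 E.
rewrite -!comp_assoc -E; congr (_ ∘ _).
by rewrite !comp_assoc tensor_ascK comp_idl.
Qed.

Lemma braidw_yb U P Q X :
  (idm Q ⊗₁ braidw U P X) ∘ braidw U Q (P ⊗ X) ∘ (idm U ⊗₁ braidw P Q X) =
  braidw P Q (U ⊗ X) ∘ (idm P ⊗₁ braidw U Q X) ∘ braidw U P (Q ⊗ X).
Proof.
have E := braidw_widen U (braid P Q) X.
transitivity (asc Q P (U ⊗ X) ∘ ((braid P Q ▹ (U ⊗ X)) ∘ (idm P ⊗₁ braidw U Q X)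
                ∘ braidw U P (Q ⊗ X))); last by rewrite !comp_assoc.
rewrite -{}E -braidw_tensorr [braidw P Q X]/braidw tensor_compl.
move: (braidw U (Q ⊗ P) X) (braid P Q ▹ X) => b c.
rewrite !comp_assoc -(comp_assoc (_ ∘ _) (_ ⊗₁ asci _ _ _)) tensor_ascK.
by rewrite comp_idr.
Qed.

Lemma widen_braidw_asci U V W X :
  (braidw U V W ▹ X) ∘ (idm U ⊗₁ asci V W X) =
  asci V (U ⊗ W) X ∘ (idm V ⊗₁ asci U W X) ∘ braidw U V (W ⊗ X).
Proof.
rewrite /braidw widen_post -comp_assoc widen_widen !comp_assoc; congr (_ ∘ _).
rewrite /asc /asci tensor_eq_homl tensor_eq_homr !eq_hom_trans.
by apply: comp_congr => //; exact: eq_hom_irr.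
Qed.

Lemma braid_munit U : unl U ∘ braid U munit = unr U.
Proof.
pose ur := eq_hom (esym (tensor1r U)); pose c := unl U ∘ braid U munit ∘ ur.
have urK : unr U ∘ ur = idm U by exact: eq_homK.
have bE : braid U munit = eq_hom (esym (tensor1l U)) ∘ c ∘ unr U.
  rewrite /c /unl /unr /ur !comp_assoc eq_homK comp_idl -comp_assoc eq_homK.
  by rewrite comp_idr.
have [d dc] : exists d : mor U U, d ∘ c = idm U.
  exists (unr U ∘ braid munit U ∘ eq_hom (esym (tensor1l U))); rewrite /c.
  rewrite -!comp_assoc (comp_assoc (eq_hom _) (unl U)) eq_homK comp_idl.
  by rewrite (comp_assoc (braid munit U)) braid_sym comp_idl.
clearbody c ur; suff c1 : c = idm U.
  rewrite bE c1 comp_idr comp_assoc; rewrite /unl /unr !eq_hom_trans.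
  exact: eq_hom_irr.
have nat1 := braid_nat (idm U) (unl (munit : C)).
have lE : (idm munit ⊗₁ c) = eq_hom (esym (tensor1l U)) ∘ c ∘ unl U.
  apply: (@comp_eq_homI _ _ _ _ (tensor1l U)); rewrite tensor_hom1l.
  by rewrite !comp_assoc eq_homK comp_idl.
have rE : (c ⊗₁ idm munit) = eq_hom (esym (tensor1r U)) ∘ c ∘ unr U.
  apply: (@comp_eq_homI _ _ _ _ (tensor1r U)); rewrite tensor_hom1r.
  by rewrite !comp_assoc eq_homK comp_idl.
have cc : c = c ∘ c.
  move: nat1; rewrite braidE bE !tensor_compl !tensor_compr lE rE.
  rewrite /unl /unr /asc /asci !(tensor_eq_homl, tensor_eq_homr).
  rewrite -!comp_assoc !(eq_hom_trans, eq_hom_transA) => cc.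
  move: cc; rewrite [eq_hom (etrans (esym (tensor1r U)) _)]eq_hom_id comp_idl.
  rewrite (eq_hom_irr (etrans (esym (tensor1l U)) _) (esym (tensor1l U))).
  move/comp_eq_homI; rewrite comp_assoc.
  rewrite (eq_hom_irr (etrans (esym _) _) (etrans
    (congr1 (fun V => U ⊗ V) (tensor1l munit)) (tensor1r U))).
  exact: comp_eq_homIr.
by rewrite -[LHS]comp_idl -dc -comp_assoc -cc.
Qed.

End LinearTheory.

Section LieModules.
Variables (K : fieldType) (C : sym_linear_category K).

Lemma equivariant_id (U V : C) (a : mor (U ⊗ V) V) : equivariant a a (idm V).
Proof. by rewrite /equivariant tensor_id comp_idl comp_idr. Qed.

Lemma equivariant_comp (U V W X : C) (a : mor (U ⊗ V) V) (b : mor (U ⊗ W) W)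
    (c : mor (U ⊗ X) X) (f : mor W X) (g : mor V W) :
  equivariant b c f -> equivariant a b g -> equivariant a c (f ∘ g).
Proof.
rewrite /equivariant => fE gE.
by rewrite -comp_assoc gE comp_assoc fE tensor_compl comp_assoc.
Qed.

Lemma sval_inj (T : Type) (P : T -> Prop) : injective (@sval T P).
Proof.
by move=> [x Px] [y Py] /= xy; case: y / xy Py => Py; rewrite (Prop_irrelevance Px Py).
Qed.

Variable L : lie_monoid C.
Implicit Types M N : lie_module L.

Definition lie_module_id M : lie_module_hom M M :=
  exist _ (idm (M : C)) (equivariant_id (lm_act M)).

Definition lie_module_comp M N P (f : lie_module_hom N P) (g : lie_module_hom M N) :
    lie_module_hom M P :=
  exist _ (sval f ∘ sval g) (equivariant_comp (svalP f) (svalP g)).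

Lemma lie_module_idl M N (f : lie_module_hom M N) :
  lie_module_comp (lie_module_id N) f = f.
Proof. by apply: sval_inj; rewrite /= comp_idl. Qed.

Lemma lie_module_idr M N (f : lie_module_hom M N) :
  lie_module_comp f (lie_module_id M) = f.
Proof. by apply: sval_inj; rewrite /= comp_idr. Qed.

Lemma lie_module_compA M N P Q (f : lie_module_hom P Q) (g : lie_module_hom N P)
    (h : lie_module_hom M N) :
  lie_module_comp f (lie_module_comp g h) = lie_module_comp (lie_module_comp f g) h.
Proof. by apply: sval_inj; rewrite /= comp_assoc. Qed.

Definition lie_module_cat : category :=
  Category lie_module_idl lie_module_idr lie_module_compA.

(* ψ ⊞ θ = ψ ⊗ id_W + (id_V ⊗ θ) ∘ (c_{L, V} ⊗ id_W) *)
Definition boxplus (V W : C) (psi : mor (L ⊗ V) V) (theta : mor (L ⊗ W) W) :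
    mor (L ⊗ (V ⊗ W)) (V ⊗ W) :=
  psi ▹ W + (idm V ⊗₁ theta) ∘ braidw L V W.

Lemma boxplusP (V W : C) (psi : mor (L ⊗ V) V) (theta : mor (L ⊗ W) W) :
  is_lmodule psi -> is_lmodule theta -> is_lmodule (boxplus psi theta).
Proof.
rewrite /is_lmodule => psiP thetaP.
set s1 := psi ▹ W; set s2 := (idm V ⊗₁ theta) ∘ braidw L V W.
have -> : boxplus psi theta = s1 + s2 by [].
have E11 : s1 ∘ (idm L ⊗₁ s1) =
    s1 ∘ (lie_br L ▹ (V ⊗ W)) + s1 ∘ (idm L ⊗₁ s1) ∘ braidw L L (V ⊗ W).
  rewrite {1 2 4 5}/s1 -widen_nest {1}psiP widenD compDl; congr (_ + _).
    by rewrite widen_post -comp_assoc widen_widen comp_assoc.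
  rewrite widen_post -comp_assoc widen_braidw_asci !comp_assoc.
  by rewrite /widen.
have s2s2 : s2 ∘ (idm L ⊗₁ s2) = (idm V ⊗₁ (theta ∘ (idm L ⊗₁ theta)))
    ∘ (braidw L V (L ⊗ W) ∘ (idm L ⊗₁ braidw L V W)).
  rewrite /s2 !tensor_compl -(comp_assoc _ (braidw L V W)).
  rewrite (comp_assoc (braidw L V W)) braidw_nat -(comp_assoc (_ ⊗₁ theta)).
  by rewrite -(comp_assoc _ (braidw L V (L ⊗ W))).
have E22 : s2 ∘ (idm L ⊗₁ s2) =
    s2 ∘ (lie_br L ▹ (V ⊗ W)) + s2 ∘ (idm L ⊗₁ s2) ∘ braidw L L (V ⊗ W).
  rewrite s2s2 {1}thetaP tensorDr compDl; congr (_ + _).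
    rewrite /s2 -(comp_assoc _ (braidw L V W)) widen_braidw tensor_compl.
    by rewrite -(comp_assoc (_ ⊗₁ theta)) -(comp_assoc _ (braidw _ _ _)).
  have yb := braidw_yb L L V W; rewrite -[RHS]comp_assoc -yb tensor_compl.
  by rewrite -(comp_assoc (_ ⊗₁ (_ ∘ _))) (comp_assoc (_ ⊗₁ braidw L L W)).
have E21 : s2 ∘ (idm L ⊗₁ s1) = s1 ∘ (idm L ⊗₁ s2) ∘ braidw L L (V ⊗ W).
  rewrite /s1 /s2 -comp_assoc braidw_widen tensor_compl.
  by rewrite (comp_assoc (psi ▹ W)) widen_natr -!(comp_assoc (_ ⊗₁ theta)).
have E12 : s1 ∘ (idm L ⊗₁ s2) = s2 ∘ (idm L ⊗₁ s1) ∘ braidw L L (V ⊗ W).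
  by rewrite E21 -comp_assoc braidw_sym comp_idr.
rewrite tensorDr !(compDl, compDr) {1}E11 {1}E22 {1}E21 {1}E12.
by rewrite [LHS](AC (3*(1*2)) ((1*5)*((2*4)*(3*6))))%AC.
Qed.

Lemma boxplus_equivariant (V V' W W' : C)
    (psi : mor (L ⊗ V) V) (psi' : mor (L ⊗ V') V')
    (theta : mor (L ⊗ W) W) (theta' : mor (L ⊗ W') W')
    (f : mor V V') (g : mor W W') :
  equivariant psi psi' f -> equivariant theta theta' g ->
  equivariant (boxplus psi theta) (boxplus psi' theta') (f ⊗₁ g).
Proof.
rewrite /equivariant /boxplus compDl compDr => fE gE; congr (_ + _).
  rewrite /widen comp_assoc -tensor_comp comp_idr fE -(comp_idl g).
  rewrite (tensor_comp psi') -[LHS]comp_assoc -asci_nat -[RHS]comp_assoc.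
  by rewrite comp_idl comp_assoc.
rewrite -[RHS]comp_assoc braidw_nat (comp_assoc (f ⊗₁ g)) -tensor_comp comp_idr.
by rewrite gE -{1}(comp_idl f) tensor_comp -comp_assoc.
Qed.

Lemma boxplus_asc (U V W : C) (psi : mor (L ⊗ U) U) (theta : mor (L ⊗ V) V)
    (xi : mor (L ⊗ W) W) :
  equivariant (boxplus (boxplus psi theta) xi) (boxplus psi (boxplus theta xi))
    (asc U V W).
Proof.
have shift : forall f g : mor (L ⊗ ((U ⊗ V) ⊗ W)) (U ⊗ (V ⊗ W)),
    f ∘ (idm L ⊗₁ asci U V W) = g ∘ (idm L ⊗₁ asci U V W) -> f = g.
  by move=> f g; rewrite /asci tensor_eq_homl; apply: comp_eq_homIr.
rewrite /equivariant; apply: shift.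
rewrite -[RHS]comp_assoc tensor_asciK comp_idr {1 2}/boxplus.
rewrite widenD !(compDr, compDl) -addrA; congr (_ + _).
  by rewrite -(comp_assoc (asc _ _ _)) widen_widen comp_assoc asciK comp_idl.
rewrite [in RHS]/boxplus tensorDr compDl; congr (_ + _).
  rewrite widen_post -2!(comp_assoc _ _ (_ ⊗₁ asci _ _ _)) widen_braidw_asci.
  rewrite /widen tensor_compl; move: (braidw L U (V ⊗ W)) => b.
  rewrite !comp_assoc asc_nat -(comp_assoc (_ ⊗₁ _) (asc _ _ _)) asciK.
  by rewrite comp_idr.
rewrite tensor_compl -(comp_assoc _ (_ ⊗₁ braidw L V W)) -braidw_tensorr.
rewrite -tensor_id; move: (braidw L (U ⊗ V) W) => b.
by rewrite !comp_assoc asc_nat.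
Qed.

Lemma boxplus_unl (V : C) (theta : mor (L ⊗ V) V) :
  equivariant (boxplus 0 theta) theta (unl V).
Proof.
rewrite /equivariant /boxplus /widen tensor0l comp0l add0r comp_assoc.
rewrite tensor_hom1l -comp_assoc; congr (_ ∘ _); rewrite braidwE !comp_assoc.
have -> : eq_hom (tensor1l (L ⊗ V)) ∘ asc munit L V = unl L ⊗₁ idm V.
  by rewrite /asc /unl tensor_eq_homr eq_hom_trans; exact: eq_hom_irr.
rewrite -tensor_compr braid_munit /unr /unl /asci tensor_eq_homl tensor_eq_homr.
by rewrite eq_hom_trans; exact: eq_hom_irr.
Qed.

Lemma boxplus_unr (V : C) (psi : mor (L ⊗ V) V) :
  equivariant (boxplus psi 0) psi (unr V).
Proof.
rewrite /equivariant /boxplus /widen tensor0r comp0l addr0 comp_assoc.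
rewrite tensor_hom1r -comp_assoc; congr (_ ∘ _).
by rewrite /unr /asci tensor_eq_homl eq_hom_trans; exact: eq_hom_irr.
Qed.

Lemma lie_module_eq M N (e : (M : C) = N) :
  equivariant (lm_act M) (lm_act N) (eq_hom e) -> M = N.
Proof.
case: M N e => [V a aP] [W b bP] /= e; case: W / e b bP => b bP /=.
rewrite /equivariant tensor_id comp_idl comp_idr => ab.
by case: b / ab bP => bP; rewrite (Prop_irrelevance aP bP).
Qed.

Lemma sval_eq_hom (M N : lie_module_cat) (e : M = N) (e' : lm_ob M = lm_ob N) :
  sval (eq_hom e) = eq_hom e'.
Proof. by case: N / e e' => e'; rewrite [RHS]eq_hom_id. Qed.

Definition lie_module_tensor M N : lie_module L :=
  LieModule (boxplusP (lm_actP M) (lm_actP N)).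

Definition lie_module_tensor_hom (M M' N N' : lie_module L)
    (f : lie_module_hom M M') (g : lie_module_hom N N') :
    lie_module_hom (lie_module_tensor M N) (lie_module_tensor M' N') :=
  exist _ (sval f ⊗₁ sval g) (boxplus_equivariant (svalP f) (svalP g)).

Lemma lie_module_tensorP :
  @is_bifunctor lie_module_cat lie_module_cat lie_module_cat
    lie_module_tensor lie_module_tensor_hom.
Proof.
split=> [M N|M M' M'' N N' N'' f g h k]; apply: sval_inj => /=.
  exact: tensor_id.
exact: tensor_comp.
Qed.

Definition lie_module_bifunctor :
    bifunctor lie_module_cat lie_module_cat lie_module_cat :=
  Bifunctor lie_module_tensorP.
Local Notation LT := lie_module_bifunctor.

Lemma lie_module_unitP : is_lmodule (0 : mor (L ⊗ munit) munit).
Proof. by rewrite /is_lmodule tensor0r !comp0l addr0. Qed.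

Definition lie_module_unit : lie_module_cat := LieModule lie_module_unitP.

Lemma lie_module_tensorA (M N P : lie_module_cat) :
  LT (LT M N) P = LT M (LT N P).
Proof.
exact: (@lie_module_eq (lie_module_tensor (lie_module_tensor M N) P)
  (lie_module_tensor M (lie_module_tensor N P))
  (tensorA (lm_ob M) (lm_ob N) (lm_ob P)) (boxplus_asc _ _ _)).
Qed.

Lemma lie_module_tensor1l (M : lie_module_cat) : LT lie_module_unit M = M.
Proof.
exact: (@lie_module_eq (lie_module_tensor lie_module_unit M) M
  (tensor1l (lm_ob M)) (boxplus_unl _)).
Qed.

Lemma lie_module_tensor1r (M : lie_module_cat) : LT M lie_module_unit = M.
Proof.
exact: (@lie_module_eq (lie_module_tensor M lie_module_unit) M
  (tensor1r (lm_ob M)) (boxplus_unr _)).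
Qed.

Lemma lie_module_tensor_homA (U U' V V' W W' : lie_module_cat)
    (f : mor U U') (g : mor V V') (h : mor W W') :
  eq_hom (lie_module_tensorA U' V' W') ∘ bif_hom LT (bif_hom LT f g) h =
  bif_hom LT f (bif_hom LT g h) ∘ eq_hom (lie_module_tensorA U V W).
Proof.
apply: sval_inj => /=.
rewrite (sval_eq_hom (lie_module_tensorA U V W)
  (tensorA (lm_ob U) (lm_ob V) (lm_ob W))).
rewrite (sval_eq_hom (lie_module_tensorA U' V' W')
  (tensorA (lm_ob U') (lm_ob V') (lm_ob W'))).
exact: tensor_homA.
Qed.

Lemma lie_module_tensor_hom1l (U U' : lie_module_cat) (f : mor U U') :
  eq_hom (lie_module_tensor1l U')
    ∘ bif_hom LT (idm lie_module_unit) f =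
  f ∘ eq_hom (lie_module_tensor1l U).
Proof.
apply: sval_inj => /=.
rewrite (sval_eq_hom (lie_module_tensor1l U) (tensor1l (lm_ob U))).
rewrite (sval_eq_hom (lie_module_tensor1l U') (tensor1l (lm_ob U'))).
exact: tensor_hom1l.
Qed.

Lemma lie_module_tensor_hom1r (U U' : lie_module_cat) (f : mor U U') :
  eq_hom (lie_module_tensor1r U')
    ∘ bif_hom LT f (idm lie_module_unit) =
  f ∘ eq_hom (lie_module_tensor1r U).
Proof.
apply: sval_inj => /=.
rewrite (sval_eq_hom (lie_module_tensor1r U) (tensor1r (lm_ob U))).
rewrite (sval_eq_hom (lie_module_tensor1r U') (tensor1r (lm_ob U'))).
exact: tensor_hom1r.
Qed.

Definition lie_module_monoidal : strict_monoidal :=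
  StrictMonoidal lie_module_tensor_homA lie_module_tensor_hom1l
    lie_module_tensor_hom1r.

End LieModules.

Section WeakModules.
Variables (K : fieldType) (C : sym_linear_category K) (X : lie_rinehart C).
Implicit Types M N : weak_module X.

Definition weak_module_id M : weak_module_hom M M :=
  exist _ (idm (M : C))
    (conj (equivariant_id (wm_rho M)) (equivariant_id (wm_gamma M))).

Definition weak_module_comp M N P (f : weak_module_hom N P)
    (g : weak_module_hom M N) : weak_module_hom M P :=
  exist _ (sval f ∘ sval g)
    (conj (equivariant_comp (proj1 (svalP f)) (proj1 (svalP g)))
          (equivariant_comp (proj2 (svalP f)) (proj2 (svalP g)))).

Lemma weak_module_idl M N (f : weak_module_hom M N) :
  weak_module_comp (weak_module_id N) f = f.
Proof. by apply: sval_inj; rewrite /= comp_idl. Qed.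

Lemma weak_module_idr M N (f : weak_module_hom M N) :
  weak_module_comp f (weak_module_id M) = f.
Proof. by apply: sval_inj; rewrite /= comp_idr. Qed.

Lemma weak_module_compA M N P Q (f : weak_module_hom P Q)
    (g : weak_module_hom N P) (h : weak_module_hom M N) :
  weak_module_comp f (weak_module_comp g h) =
  weak_module_comp (weak_module_comp f g) h.
Proof. by apply: sval_inj; rewrite /= comp_assoc. Qed.

Definition weak_module_cat : category :=
  Category weak_module_idl weak_module_idr weak_module_compA.

(* ψ ▷ ρ = (id_V ⊗ ρ) ∘ (c_{A, V} ⊗ id_M); it depends on V only, not on ψ *)
Definition act_rho (V M : C) (rho : mor (lrA X ⊗ M) M) :
    mor (lrA X ⊗ (V ⊗ M)) (V ⊗ M) :=
  (idm V ⊗₁ rho) ∘ braidw (lrA X) V M.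

(* ψ ▷ γ = (id_V ⊗ γ) ∘ (c_{L, V} ⊗ id_M)
           + (ψ ⊗ ρ) ∘ (id_G ⊗ c_{A, V} ⊗ id_M) ∘ (H ⊗ id_V ⊗ id_M) *)
Definition act_gamma (G : lie_monoid C) (H : mor (lrL X) (G ⊗ lrA X))
    (V M : C) (psi : mor (G ⊗ V) V)
    (rho : mor (lrA X ⊗ M) M) (gamma : mor (lrL X ⊗ M) M) :
    mor (lrL X ⊗ (V ⊗ M)) (V ⊗ M) :=
  (idm V ⊗₁ gamma) ∘ braidw (lrL X) V M +
  (psi ⊗₁ rho) ∘ mid G (lrA X) V M ∘ (H ⊗₁ (idm V ⊗₁ idm M)).

End WeakModules.

(* Main.v *)
(* Write N = V ⊗ M. On N there are: the A-action r = ψ ▷ ρ, the L-action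
   γ₀ = (id ⊗ γ) ∘ (c ⊗ id), with which N is a weak module, and the G-action
   p = ψ ⊗ id, which commutes with r and γ₀. In Sweedler notation
   H x = h_x ⊗ a_x, one has ψ ▷ γ = γ₀ + t with t x n = h_x (a_x n). Then
   - [γ₀ x, t y] is (h_y ⊗ x(a_y)) acting on N, as γ₀ is compatible with r;
   - [t x, t y] is ([h_x, h_y] ⊗ a_x a_y) acting on N, as A is commutative;
   and the sum of the corresponding terms for (x, y), antisymmetrised where
   necessary, is H [x, y] acting on N by the crossed homomorphism identity.
   The associativity constraint is equivariant because t is additive in p, and
   ψ ⊞ θ splits into the actions of G on V and on W. *)
Require Import Defs.
From mathcomp Require Import all_boot all_algebra boolp reals complex.
Set Implicit Arguments.
Unset Strict Implicit.
Unset Printing Implicit Defensive.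
Import GRing.Theory.
Local Open Scope ring_scope.
Local Open Scope cat_scope.

(* Syntactic versions of [rewrite -!comp_assoc] and [rewrite !tensor_compl],
   which would unfold braidw, widen and cowiden. *)
Ltac assocr := repeat match goal with
  |- context [compm (compm ?f ?g) ?h] => rewrite -(comp_assoc f g h) end.
Ltac distl := repeat match goal with
  |- context [bif_hom _ (idm ?U) (compm ?f ?g)] => rewrite (tensor_compl U f g)
  end.

(** * Braidings against morphisms into a tensor product *)

Section Cowiden.
Variables (K : fieldType) (C : sym_linear_category K).
Implicit Types U V W X Y Z : C.

(* Makes an equation f ∘ g = k usable inside a right-nested composite. *)
Lemma comp_rew X Y Z Z' (f : mor Y Z') (g : mor X Y) (k : mor X Z') :
  f ∘ g = k -> forall h : mor Z X, f ∘ (g ∘ h) = k ∘ h.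
Proof. by move=> <- h; rewrite comp_assoc. Qed.

(* Dual to widen: keeps the target bracketed to the right. *)
Definition cowiden X Y Z (f : mor X (Y ⊗ Z)) W : mor (X ⊗ W) (Y ⊗ (Z ⊗ W)) :=
  asc Y Z W ∘ (f ⊗₁ idm W).

Lemma cowiden_natr X Y Z (f : mor X (Y ⊗ Z)) W W' (g : mor W W') :
  cowiden f W' ∘ (idm X ⊗₁ g) = (idm Y ⊗₁ (idm Z ⊗₁ g)) ∘ cowiden f W.
Proof.
rewrite /cowiden -comp_assoc -tensor_split tensor_split'.
by rewrite [LHS]comp_assoc [RHS]comp_assoc -asc_nat tensor_id.
Qed.

Lemma braidw_cowiden U X Y Z (f : mor X (Y ⊗ Z)) W :
  (idm Y ⊗₁ braidw U Z W) ∘ braidw U Y (Z ⊗ W) ∘ (idm U ⊗₁ cowiden f W) =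
  cowiden f (U ⊗ W) ∘ braidw U X W.
Proof.
rewrite -braidw_tensorr -[LHS]comp_assoc -tensor_compl /cowiden.
rewrite (comp_assoc (asci _ _ _)) ascK comp_idl.
by rewrite -[LHS]comp_assoc braidw_nat tensor_id -[RHS]comp_assoc.
Qed.

(** This is [braidw_cowiden] solved for the opposite braidings, which are inverse to the given ones
    by symmetry. *)
Lemma cowiden_braidw U X Y Z (f : mor X (Y ⊗ Z)) W :
  (idm U ⊗₁ cowiden f W) ∘ braidw X U W =
  braidw Y U (Z ⊗ W) ∘ (idm Y ⊗₁ braidw Z U W) ∘ cowiden f (U ⊗ W).
Proof.
have E : braidw Y U (Z ⊗ W) ∘ (idm Y ⊗₁ braidw Z U W) ∘
    ((idm Y ⊗₁ braidw U Z W) ∘ braidw U Y (Z ⊗ W)) = idm _.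
  rewrite comp_assoc -(comp_assoc (braidw Y U _)) -tensor_compl braidw_sym.
  by rewrite tensor_id comp_idr braidw_sym.
rewrite -[LHS]comp_idl -{}E -[LHS]comp_assoc (comp_assoc (_ ∘ braidw _ _ _)).
by rewrite braidw_cowiden -(comp_assoc (cowiden _ _)) braidw_sym comp_idr.
Qed.

Lemma cowiden_widen X Y Z Z' X' (f : mor (X ⊗ Y) X') (g : mor X' (Z ⊗ Z')) W :
  cowiden g W ∘ (f ▹ W) = asc Z Z' W ∘ ((g ∘ f) ▹ W).
Proof. by rewrite widen_post comp_assoc. Qed.

(** Both sides apply [f], a braiding and [g] in turn and differ only by rebracketing; the nested
    form is the one met when an action passes through [cowiden f]. *)
Lemma asc_widen_braidw U P Q X Y (f : mor X (P ⊗ Q)) (g : mor (U ⊗ Q) Y) W :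
  asc P Y W ∘ (((idm P ⊗₁ g) ∘ braidw U P Q ∘ (idm U ⊗₁ f)) ▹ W) =
  (idm P ⊗₁ (g ▹ W)) ∘ braidw U P (Q ⊗ W) ∘ (idm U ⊗₁ cowiden f W).
Proof.
rewrite widen_pre widen_post {2}/widen /cowiden !tensor_compl.
rewrite -(comp_assoc _ _ (braidw U P _)) (comp_assoc _ (_ ⊗₁ asc _ _ _)).
rewrite -(comp_assoc _ _ (_ ⊗₁ asc _ _ _)).
have -> : (idm P ⊗₁ asci U Q W) ∘ braidw U P (Q ⊗ W) ∘ (idm U ⊗₁ asc P Q W) =
    asc P (U ⊗ Q) W ∘ (braidw U P Q ▹ W).
  rewrite -[LHS]comp_idl -(asciK P (U ⊗ Q) W) -[LHS]comp_assoc; congr (_ ∘ _).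
  have := widen_braidw_asci U P Q W; move: (braidw U P (Q ⊗ W)) => b E.
  rewrite (comp_assoc (asci _ _ _)) (comp_assoc (asci _ _ _)) -{}E.
  by rewrite -[LHS]comp_assoc tensor_ascK comp_idr.
by rewrite [LHS]comp_assoc comp_assoc asc_nat !comp_assoc.
Qed.

(** The second hexagon in solved form; it serves to recognise the term with c_{A,L} in the crossed
    homomorphism identity. *)
Lemma braid_tensorl U V W :
  braidw U V W ∘ braid (V ⊗ W) U = (idm V ⊗₁ braid W U) ∘ asc V W U.
Proof.
have E : (idm V ⊗₁ braid W U) ∘ asc V W U ∘ braid U (V ⊗ W) = braidw U V W.
  rewrite braidE !comp_assoc -(comp_assoc _ (asc V W U)) asciK comp_idr.
  by rewrite -tensor_compl braid_sym tensor_id comp_idl braidwE.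
by rewrite -E -[LHS]comp_assoc braid_sym comp_idr.
Qed.

Lemma widen_braid U V Z (f : mor (V ⊗ U) Z) W :
  (f ∘ braid U V) ▹ W = (f ▹ W) ∘ braidw U V W.
Proof.
by rewrite widen_post [in RHS]/widen /braidw -comp_assoc (comp_assoc (asci _ _ _))
  ascK comp_idl.
Qed.

(* (id_P ⊗ c_{Q, P'} ⊗ id_Q') ∘ (f ⊗ f'), tensored with W. *)
Definition cowiden2 X X' P P' Q Q' (f : mor X (P ⊗ Q)) (f' : mor X' (P' ⊗ Q')) W :
    mor (X ⊗ (X' ⊗ W)) (P ⊗ (P' ⊗ (Q ⊗ (Q' ⊗ W)))) :=
  (idm P ⊗₁ braidw Q P' (Q' ⊗ W)) ∘ cowiden f (P' ⊗ (Q' ⊗ W))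
    ∘ (idm X ⊗₁ cowiden f' W).

(** Pulling the braiding through [f'] and then [f] creates a crossing of P' and Q, which cancels by
    symmetry against the one inside [cowiden2]. *)
Lemma cowiden2_braidw X X' P P' Q Q' (f : mor X (P ⊗ Q)) (f' : mor X' (P' ⊗ Q')) W :
  cowiden2 f f' W ∘ braidw X' X W =
  braidw P' P (Q ⊗ (Q' ⊗ W)) ∘ (idm P' ⊗₁ (idm P ⊗₁ braidw Q' Q W))
    ∘ cowiden2 f' f W.
Proof.
rewrite /cowiden2; assocr; rewrite cowiden_braidw; assocr.
rewrite (comp_rew (esym (braidw_cowiden _ _ _))); assocr.
rewrite (comp_rew (esym (tensor_compl _ _ _))) braidw_sym tensor_id comp_idl.
rewrite cowiden_natr (comp_rew (esym (tensor_compl P' _ _))) -braidw_cowiden.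
by distl; assocr.
Qed.

Lemma asc_widen_mid X X' G A (f : mor X (G ⊗ A)) (f' : mor X' (G ⊗ A))
    (u : mor (G ⊗ G) G) (m : mor (A ⊗ A) A) N :
  asc G A N ∘ (((u ⊗₁ m) ∘ mid G A G A ∘ (f ⊗₁ f')) ▹ N) =
  (idm G ⊗₁ (m ▹ N)) ∘ (u ▹ (A ⊗ (A ⊗ N))) ∘ cowiden2 f f' N.
Proof.
(* Pure coherence: the only factor on either side that is not an equality morphism is c_{A,G}. *)
have coh : asc (G ⊗ G) (A ⊗ A) N ∘ (mid G A G A ▹ N) =
    (idm (G ⊗ G) ⊗₁ asci A A N) ∘ asci G G (A ⊗ (A ⊗ N))
    ∘ (idm G ⊗₁ braidw A G (A ⊗ N)) ∘ asc G A (G ⊗ (A ⊗ N))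
    ∘ (idm (G ⊗ A) ⊗₁ asc G A N).
  rewrite /mid /widen !braidwE !(tensor_compr, tensor_compl).
  rewrite 3!tensor_layerl (tensor_layerr (U := A ⊗ G)) !tensor_compl.
  rewrite /asc /asci !(tensor_eq_homl, tensor_eq_homr).
  rewrite -!comp_assoc !(eq_hom_trans, eq_hom_transA).
  by do 2! (apply: comp_congr; [by [] || exact: eq_hom_irr |]); exact: eq_hom_irr.
rewrite widen_pre widen_post /cowiden2.
move: (mid G A G A ▹ N) (braidw A G (A ⊗ N)) coh => d b coh.
rewrite !comp_assoc asc_nat -(comp_assoc (_ ⊗₁ _) (asc _ _ _)) {}coh.
rewrite !comp_assoc -(comp_assoc _ (_ ⊗₁ asc G A N)).
by rewrite -[in RHS](comp_assoc _ (f ⊗₁ _)) -!tensor_comp !comp_idl !comp_idr.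
Qed.

End Cowiden.

(** * Strict left module categories from strictly associative bifunctors *)

Section StrictModuleCategory.
Variables (D : strict_monoidal) (M : category).

Lemma bif_eq_homl (F : bifunctor D M M) (U V : D) (Z : M) (e : U = V) :
  bif_hom F (eq_hom e) (idm Z) = eq_hom (congr1 (F^~ Z) e).
Proof. by case: V / e; exact: is_bifunctor_id (bifP F) U Z. Qed.

Lemma bif_eq_homr (F : bifunctor D M M) (U : D) (Y Z : M) (e : Y = Z) :
  bif_hom F (idm U) (eq_hom e) = eq_hom (congr1 (F U) e).
Proof. by case: Z / e; exact: is_bifunctor_id (bifP F) U Y. Qed.

Lemma eq_hom_iso (U V : M) (e : U = V) : is_iso (eq_hom e).
Proof. by exists (eq_hom (esym e)); rewrite !eq_homK. Qed.

(** A bifunctor sends equality morphisms to equality morphisms, so pentagon and triangle hold by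
    irrelevance and only naturality has to be supplied. *)
Lemma strict_left_module_category (F : bifunctor D M M)
    (FA : forall (U V : D) (Z : M), F (U ⊗ V) Z = F U (F V Z))
    (F1 : forall Z : M, F munit Z = Z) :
  (forall (U U' V V' : D) (Z Z' : M) (f : mor U U') (g : mor V V') (h : mor Z Z'),
     eq_hom (FA U' V' Z') ∘ bif_hom F (f ⊗₁ g) h =
     bif_hom F f (bif_hom F g h) ∘ eq_hom (FA U V Z)) ->
  (forall (Z Z' : M) (h : mor Z Z'),
     eq_hom (F1 Z') ∘ bif_hom F (idm munit) h = h ∘ eq_hom (F1 Z)) ->
  exists N : left_module_category D M, lmc_act N = F /\ lmc_strict N.
Proof.
move=> natA nat1; unshelve eexists.
  apply: (@LeftModuleCategory _ _ F (fun U V Z => eq_hom (FA U V Z))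
    (fun Z => eq_hom (F1 Z))) => //.
  - by move=> *; exact: eq_hom_iso.
  - by move=> *; exact: eq_hom_iso.
  - move=> U V W Z; rewrite /asc bif_eq_homl bif_eq_homr !eq_hom_trans.
    exact: eq_hom_irr.
  - move=> U Z; rewrite /unr bif_eq_homl bif_eq_homr eq_hom_trans.
    exact: eq_hom_irr.
by split=> //; split=> [U V Z|Z]; [exists (FA U V Z) | exists (F1 Z)].
Qed.

End StrictModuleCategory.

(** * Actions on one factor of a tensor product *)

Section Slide.
Variables (K : fieldType) (C : sym_linear_category K).
Implicit Types U V W Y Z : C.

(* The action on the second factor of V ⊗ Y, through the braiding. *)
Definition slide U V Y Z (f : mor (U ⊗ Y) Z) : mor (U ⊗ (V ⊗ Y)) (V ⊗ Z) :=
  (idm V ⊗₁ f) ∘ braidw U V Y.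

Lemma slideD U V Y Z (f g : mor (U ⊗ Y) Z) : slide V (f + g) = slide V f + slide V g.
Proof. by rewrite /slide tensorDr compDl. Qed.

(** The analogue of [slide] for two successive actions. It is additive and respects each composite
    in the module axioms, so an axiom for [f] passes to [slide V f]. *)
Definition slide2 U U' V Y Z (f : mor (U ⊗ (U' ⊗ Y)) Z) :
    mor (U ⊗ (U' ⊗ (V ⊗ Y))) (V ⊗ Z) :=
  (idm V ⊗₁ f) ∘ braidw U V (U' ⊗ Y) ∘ (idm U ⊗₁ braidw U' V Y).

Lemma slide2D U U' V Y Z (f g : mor (U ⊗ (U' ⊗ Y)) Z) :
  slide2 V (f + g) = slide2 V f + slide2 V g.
Proof. by rewrite /slide2 tensorDr !compDl. Qed.

Lemma slide_nest U U' V Y Y' Z (f : mor (U ⊗ Y) Z) (g : mor (U' ⊗ Y') Y) :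
  slide V f ∘ (idm U ⊗₁ slide V g) = slide2 V (f ∘ (idm U ⊗₁ g)).
Proof.
rewrite /slide /slide2; distl; assocr.
by rewrite (comp_rew (braidw_nat _ _ _)); assocr.
Qed.

Lemma slide_widen U U' U'' V Y Z (f : mor (U'' ⊗ Y) Z) (g : mor (U ⊗ U') U'') :
  slide V f ∘ (g ▹ (V ⊗ Y)) = slide2 V (f ∘ (g ▹ Y)).
Proof. by rewrite /slide /slide2 -comp_assoc widen_braidw tensor_compl !comp_assoc. Qed.

(** This is the Yang-Baxter relation [braidw_yb]. *)
Lemma slide2_braidw U U' V Y Z (f : mor (U' ⊗ (U ⊗ Y)) Z) :
  slide2 V (f ∘ braidw U U' Y) = slide2 V f ∘ braidw U U' (V ⊗ Y).
Proof.
rewrite /slide2 tensor_compl; assocr.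
by have := braidw_yb U U' V Y; assocr => ->.
Qed.

(** The two actions touch different factors. This supplies [pi_rho] and [pi_gamma] below. *)
Lemma slide_widenC U V W Y Z (f : mor (U ⊗ Y) Z) (g : mor (W ⊗ V) V) :
  slide V f ∘ (idm U ⊗₁ (g ▹ Y)) = (g ▹ Z) ∘ (idm W ⊗₁ slide V f) ∘ braidw U W (V ⊗ Y).
Proof.
rewrite /slide -comp_assoc braidw_widen; distl; assocr.
by rewrite (comp_rew (widen_natr _ _)); assocr.
Qed.

Lemma unl_braidw V Y : unl (V ⊗ Y) ∘ braidw V munit Y = idm V ⊗₁ unl Y.
Proof.
have uA : unl (V ⊗ Y) ∘ asc munit V Y = unl V ⊗₁ idm Y.
  by rewrite /asc /unl tensor_eq_homr eq_hom_trans; exact: eq_hom_irr.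
rewrite braidwE !comp_assoc uA -tensor_compr braid_munit.
by rewrite /unr /unl /asci tensor_eq_homl tensor_eq_homr eq_hom_trans;
  exact: eq_hom_irr.
Qed.

Lemma slide_unl V Y : slide V (unl Y) = unl (V ⊗ Y).
Proof. by rewrite /slide -unl_braidw -comp_assoc braidw_sym comp_idr. Qed.

Lemma slide_munit U Y (f : mor (U ⊗ Y) Y) : equivariant (slide munit f) f (unl Y).
Proof. by rewrite /equivariant /slide comp_assoc tensor_hom1l -comp_assoc unl_braidw. Qed.

Lemma slide_asc U V W Y (f : mor (U ⊗ Y) Y) :
  equivariant (slide (V ⊗ W) f) (slide V (slide W f)) (asc V W Y).
Proof.
have E : asc V W (U ⊗ Y) ∘ braidw U (V ⊗ W) Y =
    (idm V ⊗₁ braidw U W Y) ∘ braidw U V (W ⊗ Y) ∘ (idm U ⊗₁ asc V W Y).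
  by rewrite -braidw_tensorr -comp_assoc tensor_ascK comp_idr.
rewrite /equivariant /slide -tensor_id comp_assoc asc_nat -comp_assoc E.
by distl; assocr.
Qed.

Lemma slide_widen_asc U V W Y (f : mor (U ⊗ V) V) :
  equivariant (slide W f ▹ Y) (slide W (f ▹ Y)) (asc W V Y).
Proof.
(* For an identity morphism, [cowiden] is the associator. *)
have := asc_widen_braidw (idm (W ⊗ V)) f Y.
by rewrite tensor_id comp_idr /cowiden tensor_id comp_idr.
Qed.

Lemma widen_widen_asc U V W Y (f : mor (U ⊗ V) V) :
  equivariant ((f ▹ W) ▹ Y) (f ▹ (W ⊗ Y)) (asc V W Y).
Proof.
rewrite /equivariant -[f ▹ (W ⊗ Y)]comp_idl -(asciK V W Y) -(comp_assoc (asc _ _ _)).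
by rewrite -widen_widen -!comp_assoc tensor_ascK comp_idr.
Qed.

Lemma slide_equivariant U V V' Y Y' (a : mor (U ⊗ Y) Y) (b : mor (U ⊗ Y') Y')
    (f : mor V V') (g : mor Y Y') :
  equivariant a b g -> equivariant (slide V a) (slide V' b) (f ⊗₁ g).
Proof.
rewrite /equivariant /slide => gE.
rewrite -[RHS]comp_assoc braidw_nat !comp_assoc -!tensor_comp gE.
by rewrite comp_idl comp_idr.
Qed.

Lemma widen_equivariant U V V' Y Y' (a : mor (U ⊗ V) V) (b : mor (U ⊗ V') V')
    (f : mor V V') (g : mor Y Y') :
  equivariant a b f -> equivariant (a ▹ Y) (b ▹ Y') (f ⊗₁ g).
Proof.
rewrite /equivariant /widen => fE.
rewrite -[RHS]comp_assoc asci_nat !comp_assoc -!tensor_comp fE.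
by rewrite comp_idl comp_idr.
Qed.

Lemma equivariantD U V V' (a a' : mor (U ⊗ V) V) (b b' : mor (U ⊗ V') V')
    (f : mor V V') :
  equivariant a b f -> equivariant a' b' f -> equivariant (a + a') (b + b') f.
Proof. by rewrite /equivariant compDl compDr => -> ->. Qed.

Lemma slide_lmodule (L : lie_monoid C) V Y (f : mor (L ⊗ Y) Y) :
  is_lmodule f -> is_lmodule (slide V f).
Proof.
by move=> fP; rewrite /is_lmodule slide_nest {1}fP slide2D -slide_widen slide2_braidw.
Qed.

Lemma slide_amodule (A : comm_monoid C) V Y (f : mor (A ⊗ Y) Y) :
  is_amodule f -> is_amodule (slide V f).
Proof.
case=> fM f1; split; first by rewrite slide_nest fM slide_widen.
rewrite /slide -tensor_id -[LHS]comp_assoc braidw_nat comp_assoc -tensor_compl f1.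
exact: slide_unl.
Qed.

Lemma slide_weak_module (X : lie_rinehart C) V Y
    (rho : mor (lrA X ⊗ Y) Y) (gamma : mor (lrL X ⊗ Y) Y) :
  is_weak_module rho gamma -> is_weak_module (slide V rho) (slide V gamma).
Proof.
case=> rhoP gammaP compat; split; [exact: slide_amodule | exact: slide_lmodule |].
by rewrite slide_nest compat slide2D -slide_widen slide2_braidw slide_nest.
Qed.

Lemma widen_lmodule (L : lie_monoid C) V Y (f : mor (L ⊗ V) V) :
  is_lmodule f -> is_lmodule (f ▹ Y).
Proof.
move=> fP; rewrite /is_lmodule.
(* With the zero action on Y, [boxplus f 0] reduces to [f ▹ Y]. *)
have := boxplusP fP (_ : is_lmodule (0 : mor (L ⊗ Y) Y)).
rewrite /boxplus tensor0r comp0l addr0; apply.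
by rewrite /is_lmodule tensor0r !comp0l addr0.
Qed.

End Slide.

(** * Twisting the Lie action of a weak module by a crossed homomorphism *)

Section LieAction.
Variables (K : fieldType) (C : sym_linear_category K) (X : lie_rinehart C).
Variables (G : lie_monoid C) (H : mor (lrL X) (G ⊗ lrA X)).
Hypothesis crossedH : is_crossed_hom H.
Variables (N : C) (rho : mor (lrA X ⊗ N) N) (gamma : mor (lrL X ⊗ N) N).
Variable pi : mor (G ⊗ N) N.
Hypothesis weakN : is_weak_module rho gamma.
Hypothesis piP : is_lmodule pi.
Hypothesis pi_rho :
  rho ∘ (idm (lrA X) ⊗₁ pi) = pi ∘ (idm G ⊗₁ rho) ∘ braidw (lrA X) G N.
Hypothesis pi_gamma :
  gamma ∘ (idm (lrL X) ⊗₁ pi) = pi ∘ (idm G ⊗₁ gamma) ∘ braidw (lrL X) G N.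

Local Notation A := (lrA X : C).
Local Notation L := (lrL X : C).

(* x ⊗ n ↦ h_x (a_x n), where H x = h_x ⊗ a_x. *)
Definition twist : mor (L ⊗ N) N := pi ∘ (idm G ⊗₁ rho) ∘ cowiden H N.

Lemma amodule_mulC : rho ∘ (idm A ⊗₁ rho) ∘ braidw A A N = rho ∘ (idm A ⊗₁ rho).
Proof.
by rewrite (amodule_mul (weak_amodule weakN)) -[LHS]comp_assoc -widen_braid cm_mulC.
Qed.

(** An element b of A passes h_x by [pi_rho] and a_x by commutativity of A, so [twist] adds no
    anchor term to the compatibility condition. *)
Lemma twist_rho :
  twist ∘ (idm L ⊗₁ rho) = rho ∘ (idm A ⊗₁ twist) ∘ braidw L A N.
Proof.
rewrite /twist; distl; assocr; rewrite cowiden_braidw cowiden_natr.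
rewrite (comp_rew pi_rho); assocr; rewrite (comp_rew (braidw_nat _ _ _)); assocr.
rewrite (comp_rew (braidw_sym _ _ _)) comp_idl; congr (_ ∘ _).
rewrite !(comp_assoc (_ ⊗₁ rho)) -(tensor_compl G) -{1}amodule_mulC.
by distl; assocr.
Qed.

(* x ⊗ y ↦ h_y ⊗ x(a_y). *)
Definition anchor_part : mor (L ⊗ L) (G ⊗ A) :=
  (idm G ⊗₁ lr_anchor X) ∘ braidw L G A ∘ (idm L ⊗₁ H).

(* x ⊗ y ↦ [h_x, h_y] ⊗ a_x a_y. *)
Definition bracket_part : mor (L ⊗ L) (G ⊗ A) :=
  (lie_br G ⊗₁ cm_mul A) ∘ mid G A G A ∘ (H ⊗₁ H).

(** The action of x passes h_y by [pi_gamma]; passing a_y then costs x(a_y), by [weak_compat]. *)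
Lemma twist_gamma :
  gamma ∘ (idm L ⊗₁ twist) =
  pi ∘ (idm G ⊗₁ rho) ∘ (asc G A N ∘ (anchor_part ▹ N))
  + twist ∘ (idm L ⊗₁ gamma) ∘ braidw L L N.
Proof.
rewrite asc_widen_braidw /twist; distl; assocr; rewrite (comp_rew pi_gamma); assocr.
rewrite (comp_rew (braidw_nat _ _ _)); assocr.
rewrite (comp_rew (esym (tensor_compl G _ _))) (weak_compat weakN).
rewrite tensorDr compDl compDr; distl; assocr; congr (_ + _).
rewrite (comp_rew (cowiden_natr _ _)); assocr.
by rewrite -braidw_cowiden -comp_assoc.
Qed.

(** A normal form: [pi_rho] moves a_x past h_y, so that both elements of A act before both elements
    of G. *)
Lemma twist_twist :
  twist ∘ (idm L ⊗₁ twist) =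
  pi ∘ (idm G ⊗₁ pi) ∘ (idm G ⊗₁ (idm G ⊗₁ (rho ∘ (idm A ⊗₁ rho))))
    ∘ cowiden2 H H N.
Proof.
rewrite /twist /cowiden2; distl; assocr.
rewrite (comp_rew (cowiden_natr _ _)); assocr.
rewrite (comp_rew (esym (tensor_compl G rho _))) pi_rho; distl; assocr.
rewrite (comp_rew (cowiden_natr _ _)); assocr.
rewrite (comp_rew (esym (tensor_compl G (braidw _ _ _) _))) braidw_nat.
by distl; assocr.
Qed.

(** In the normal form, [piP] exchanges h_x and h_y at the cost of [h_x, h_y], and commutativity
    exchanges a_x and a_y; by [cowiden2_braidw] this amounts to exchanging x and y. *)
Lemma twist_lie :
  twist ∘ (idm L ⊗₁ twist) =
  pi ∘ (idm G ⊗₁ rho) ∘ (asc G A N ∘ (bracket_part ▹ N))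
  + twist ∘ (idm L ⊗₁ twist) ∘ braidw L L N.
Proof.
rewrite twist_twist asc_widen_mid {1}piP !compDl; congr (_ + _).
  rewrite -(comp_assoc pi) widen_natr (amodule_mul (weak_amodule weakN)).
  by distl; assocr.
assocr; rewrite cowiden2_braidw; assocr; congr (_ ∘ (_ ∘ _)).
rewrite [in RHS](comp_rew (esym (braidw_nat _ _ _))); assocr; congr (_ ∘ _).
by rewrite -{1}amodule_mulC; distl; assocr.
Qed.

(** The negative term is [anchor_part] with its inputs exchanged; moving it to the left avoids
    signs. *)
Lemma crossed_homE :
  H ∘ lie_br (lrL X) + anchor_part ∘ braid L L = anchor_part + bracket_part.
Proof.
rewrite crossedH -/anchor_part -/bracket_part.
have -> : anchor_part ∘ braid L L = (idm G ⊗₁ (lr_anchor X ∘ braid A L))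
    ∘ asc G A L ∘ (H ⊗₁ idm L).
  rewrite /anchor_part; distl; assocr; rewrite -braid_nat.
  by rewrite (comp_rew (braid_tensorl _ _ _)); assocr.
by rewrite addrAC addrNK.
Qed.

Lemma twist_weak_module : is_weak_module rho (gamma + twist).
Proof.
split; first exact: weak_amodule weakN.
  have gt := twist_gamma; have tt := twist_lie.
  (* [crossed_homE], applied to N through [rho] and then [pi]. *)
  have br : twist ∘ (lie_br (lrL X) ▹ N)
      + pi ∘ (idm G ⊗₁ rho) ∘ (asc G A N ∘ (anchor_part ▹ N)) ∘ braidw L L N
      = pi ∘ (idm G ⊗₁ rho) ∘ (asc G A N ∘ (anchor_part ▹ N))
      + pi ∘ (idm G ⊗₁ rho) ∘ (asc G A N ∘ (bracket_part ▹ N)).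
    rewrite -!compDr -widenD -crossed_homE widenD !compDr widen_braid /twist.
    congr (_ + _).
      by assocr; rewrite cowiden_widen.
    by rewrite !comp_assoc.
  move: br gt tt; set a := _ ∘ (asc G A N ∘ (anchor_part ▹ N)).
  set b := _ ∘ (asc G A N ∘ (bracket_part ▹ N)); clearbody a b => br gt tt.
  (* [gt] with x and y exchanged. *)
  have tg : twist ∘ (idm L ⊗₁ gamma) + a ∘ braidw L L N =
      gamma ∘ (idm L ⊗₁ twist) ∘ braidw L L N.
    rewrite gt compDl -comp_assoc braidw_sym comp_idr; exact: addrC.
  rewrite /is_lmodule tensorDr !(compDl, compDr) {1}(weak_lmodule weakN) {1}gt {1}tt.
  (* The reordering isolates the left-hand side of [br]; after its use both sides have the same
     seven terms. *)
  rewrite -tg [RHS](AC (2*((1*2)*2)) ((2*5)*(1*3*6*7*4)))%AC /= br.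
  by rewrite [LHS](AC ((2*2)*(1*2)) ((3*6)*(1*2*4*7*5)))%AC.
rewrite compDl (weak_compat weakN) twist_rho tensorDr compDr compDl.
by rewrite addrA.
Qed.

End LieAction.

(** * The action of Lie modules on weak modules *)

Section Action.
Variables (K : fieldType) (C : sym_linear_category K) (X : lie_rinehart C).
Variables (G : lie_monoid C) (H : mor (lrL X) (G ⊗ lrA X)).
Implicit Types V M : C.

Lemma act_gammaE V M (psi : mor (G ⊗ V) V) (rho : mor (lrA X ⊗ M) M)
    (gamma : mor (lrL X ⊗ M) M) :
  act_gamma H psi rho gamma =
  slide V gamma + twist H (slide V rho) (psi ▹ M).
Proof.
rewrite /act_gamma /slide /twist /mid /cowiden tensor_id; congr (_ + _).
rewrite tensor_split /widen; distl; assocr.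
by rewrite (comp_rew (asci_nat _ _ _)) tensor_id; assocr.
Qed.

Lemma twist_equivariant M M' (rho : mor (lrA X ⊗ M) M) (rho' : mor (lrA X ⊗ M') M')
    (pi : mor (G ⊗ M) M) (pi' : mor (G ⊗ M') M') (f : mor M M') :
  equivariant rho rho' f -> equivariant pi pi' f ->
  equivariant (twist H rho pi) (twist H rho' pi') f.
Proof.
rewrite /equivariant /twist => rhoE piE; assocr.
rewrite cowiden_natr (comp_rew piE); assocr.
by rewrite !(comp_rew (esym (tensor_compl G _ _))) rhoE.
Qed.

(** V passes both outputs of H by [cowiden_braidw]. *)
Lemma slide_twist V M (rho : mor (lrA X ⊗ M) M) (pi : mor (G ⊗ M) M) :
  slide V (twist H rho pi) = twist H (slide V rho) (slide V pi).
Proof.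
rewrite /slide /twist; distl; assocr; rewrite cowiden_braidw; assocr.
by rewrite (comp_rew (braidw_nat _ _ _)); assocr.
Qed.

Lemma twistDr M (rho : mor (lrA X ⊗ M) M) (pi pi' : mor (G ⊗ M) M) :
  twist H rho (pi + pi') = twist H rho pi + twist H rho pi'.
Proof. by rewrite /twist !compDl. Qed.

Lemma act_weak_module (crossedH : is_crossed_hom H) V M (psi : mor (G ⊗ V) V)
    (rho : mor (lrA X ⊗ M) M) (gamma : mor (lrL X ⊗ M) M) :
  is_lmodule psi -> is_weak_module rho gamma ->
  is_weak_module (act_rho V rho) (act_gamma H psi rho gamma).
Proof.
move=> psiP MP; rewrite act_gammaE; apply: twist_weak_module => //.
- exact: slide_weak_module.
- exact: widen_lmodule.
- exact: slide_widenC.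
- exact: slide_widenC.
Qed.

Lemma act_equivariant V V' M M' (psi : mor (G ⊗ V) V) (psi' : mor (G ⊗ V') V')
    (rho : mor (lrA X ⊗ M) M) (gamma : mor (lrL X ⊗ M) M)
    (rho' : mor (lrA X ⊗ M') M') (gamma' : mor (lrL X ⊗ M') M')
    (f : mor V V') (g : mor M M') :
  equivariant psi psi' f -> equivariant rho rho' g -> equivariant gamma gamma' g ->
  equivariant (act_gamma H psi rho gamma) (act_gamma H psi' rho' gamma') (f ⊗₁ g).
Proof.
move=> fE rhoE gammaE; rewrite !act_gammaE.
apply: equivariantD; first exact: slide_equivariant.
by apply: twist_equivariant; [apply: slide_equivariant | apply: widen_equivariant].
Qed.

Lemma act_weak_module_hom (crossedH : is_crossed_hom H) (V V' : lie_module G)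
    (M M' : weak_module X) (f : lie_module_hom V V') (g : weak_module_hom M M') :
  @is_weak_module_hom _ _ X
    (WeakModule (act_weak_module crossedH (lm_actP V) (wmP M)))
    (WeakModule (act_weak_module crossedH (lm_actP V') (wmP M')))
    (sval f ⊗₁ sval g).
Proof.
case: f g => [f fE] [g [rhoE gammaE]]; split; first exact: slide_equivariant.
exact: act_equivariant.
Qed.

Lemma act_asc V W M (psi : mor (G ⊗ V) V) (theta : mor (G ⊗ W) W)
    (rho : mor (lrA X ⊗ M) M) (gamma : mor (lrL X ⊗ M) M) :
  equivariant (act_gamma H (boxplus psi theta) rho gamma)
    (act_gamma H psi (act_rho W rho) (act_gamma H theta rho gamma)) (asc V W M).
Proof.
rewrite !act_gammaE slideD slide_twist /boxplus widenD twistDr -addrA.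
apply: equivariantD; first exact: slide_asc.
(* The two sides list the actions of G on V and on W in opposite orders. *)
rewrite addrC; apply: equivariantD; apply: twist_equivariant.
- exact: slide_asc.
- exact: widen_widen_asc.
- exact: slide_asc.
- exact: slide_widen_asc.
Qed.

Lemma act_unl M (rho : mor (lrA X ⊗ M) M) (gamma : mor (lrL X ⊗ M) M) :
  equivariant (act_gamma H 0 rho gamma) gamma (unl M).
Proof.
rewrite act_gammaE /widen tensor0l comp0l /twist !comp0l addr0; exact: slide_munit.
Qed.

End Action.

(** * Strictness on objects, and the conclusion *)

Section WeakModuleEq.
Variables (K : fieldType) (C : sym_linear_category K) (X : lie_rinehart C).

(** Once [e] is eliminated, the homomorphism condition says that the actions agree. Strictness thus
    reduces to equivariance of associators and unitors. *)
Lemma weak_module_eq (M N : weak_module X) (e : (M : C) = N) :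
  is_weak_module_hom (eq_hom e) -> M = N.
Proof.
case: M N e => [V r g P] [W r' g' P'] /= e; case: W / e r' g' P' => r' g' P' /=.
rewrite /is_weak_module_hom /equivariant !tensor_id !comp_idl !comp_idr /=.
by case=> rr gg; case: r' / rr P'; case: g' / gg => P'; rewrite (Prop_irrelevance P P').
Qed.

Lemma sval_weak_eq_hom (M N : weak_module_cat X) (e : M = N)
    (e' : wm_ob M = wm_ob N) :
  sval (eq_hom e) = eq_hom e'.
Proof. by case: N / e e' => e'; rewrite [RHS]eq_hom_id. Qed.

End WeakModuleEq.

Theorem theorem3p18 (R : realType) (C : sym_linear_category R[i])
    (X : lie_rinehart C) (G : lie_monoid C)
    (H : mor (lrL X) (G ⊗ lrA X)) (crossedH : is_crossed_hom H) :
  exists (F_obP : forall (V : lie_module G) (M : weak_module X),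
            is_weak_module (act_rho V (wm_rho M))
              (act_gamma H (lm_act V) (wm_rho M) (wm_gamma M)))
         (F_homP : forall (V V' : lie_module G) (M M' : weak_module X)
              (f : lie_module_hom V V') (g : weak_module_hom M M'),
            @is_weak_module_hom _ _ X
              (WeakModule (F_obP V M)) (WeakModule (F_obP V' M'))
              (sval f ⊗₁ sval g))
         (FP : @is_bifunctor
            (lie_module_monoidal G) (weak_module_cat X) (weak_module_cat X)
            (fun V M => WeakModule (F_obP V M))
            (fun V V' M M' f g =>
               exist _ (sval f ⊗₁ sval g) (F_homP V V' M M' f g)))
         (N : left_module_category (lie_module_monoidal G) (weak_module_cat X)),
    lmc_act N = Bifunctor FP /\ lmc_strict N.
Proof.
exists (fun V M => act_weak_module crossedH (lm_actP V) (wmP M)).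
exists (act_weak_module_hom crossedH).
unshelve eexists.
  by split=> *; apply: sval_inj; [exact: tensor_id | exact: tensor_comp].
set F := Bifunctor _.
have assocE (U V : lie_module_monoidal G) (Z : weak_module_cat X) :
    F (U ⊗ V) Z = F U (F V Z).
  apply: (@weak_module_eq _ _ _ (F (U ⊗ V) Z) (F U (F V Z))
    (tensorA (lm_ob U) (lm_ob V) (wm_ob Z))).
  by split; [exact: slide_asc | exact: act_asc].
have unitE (Z : weak_module_cat X) : F munit Z = Z.
  apply: (@weak_module_eq _ _ _ (F munit Z) Z (tensor1l (wm_ob Z))).
  by split; [exact: slide_munit | exact: act_unl].
apply: (@strict_left_module_category _ _ F assocE unitE).
  (* The constraints have the associators and unitors of C as underlying morphisms, so naturality is
     inherited from C. *)
  move=> U U' V V' Z Z' f g h; apply: sval_inj => /=.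
  rewrite (sval_weak_eq_hom (assocE U V Z) (tensorA (lm_ob U) (lm_ob V) (wm_ob Z))).
  rewrite (sval_weak_eq_hom (assocE U' V' Z')
    (tensorA (lm_ob U') (lm_ob V') (wm_ob Z'))).
  exact: tensor_homA.
move=> Z Z' h; apply: sval_inj => /=.
rewrite (sval_weak_eq_hom (unitE Z) (tensor1l (wm_ob Z))).
rewrite (sval_weak_eq_hom (unitE Z') (tensor1l (wm_ob Z'))).
exact: tensor_hom1l.
Qed.
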